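(* For every integer $d \ge 2$ and every real $\epsilon > 0$, there exist a constant $C_d < \frac{1}{2}+\epsilon$ and a threshold $t(\epsilon)$ (both chosen after $d$ and $\epsilon$ are given) such that for all integers $t \ge t(\epsilon)$ there is a family $\mathcal{F}_t= \{(A^1_i, A^2_i,\ldots, A^d_i) : 1\leq i\leq t \}$ of $t$ $d$-tuples of finite sets with the property that, for all $i,i'\in\{1,\dots,t\}$ and $j,j'\in\{1,\dots,d\}$, $A^j_i \cap A^{j'}_{i'}=\emptyset$ if and only if $i= i'$ and $j\neq j'$, and $$\sum_{i=1}^{t}\sum_{j=1}^{d} |A^j_i| \le C_d\, d\, t\log_2 t.$$
   Context: The superscript $j$ in $A_i^j$ is an index (position in the $d$-tuple), not a power. The property with $i=i'$, $j=j'$ says in particular that every $A_i^j$ is nonempty. *)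

(* Defs.v *)
From mathcomp Require Export all_boot all_order all_algebra.
From mathcomp Require Export reals exp.
Set Implicit Arguments.
Unset Strict Implicit.
Unset Printing Implicit Defensive.

Import GRing.Theory Num.Theory.
Local Open Scope ring_scope.

Definition log2 (R : realType) (x : R) : R := ln x / ln 2.

Section Family.
Variables (T : finType) (t d : nat) (A : 'I_t -> 'I_d -> {set T}).

(* A i j stands for A_i^j, with both indices starting at 0. *)
Definition tuple_disjointness : Prop :=
  forall (i i' : 'I_t) (j j' : 'I_d),
    A i j :&: A i' j' = set0 <-> i = i' /\ j <> j'.

Definition total_size : nat := (\sum_(i < t) \sum_(j < d) #|A i j|)%N.

End Family.

(* Main.v *)
(** Words over the alphabet 'I_d, seen as functions from a set of positions, give
    tuples of sets by taking the positions of each letter (plus one private point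
    per letter).  We need t words of length about (d/2) log2 t such that any two of
    them show every ordered pair of distinct letters (a, b) at some position; this
    is the theorem of Gargano, Korner and Vaccaro on qualitatively independent
    partitions.

    For a single pair (a, b), take the balanced words of length dm and colour each
    by the word obtained on identifying a with b: two words of the same colour
    show both (a, b) and (b, a), and each class has C(2m, m) elements.  To treat
    all pairs with the same words, pass to sequences of L words.  From colourings
    c1, c2 with r colours, each suited to some set of pairs, one gets a colouring
    of the sequences with r^(L+1) colours suited to the union: record the
    differences c1(x_j) - c2(x_(j-1)) mod r.  Compared with r^L the loss is
    negligible for large L, so after treating all pairs the largest colour class
    still has nearly C(2m, m)^N elements, each made of N balanced words. *)

Require Import Defs.
From mathcomp Require Import zify ring lra.

Set Implicit Arguments.
Unset Strict Implicit.
Unset Printing Implicit Defensive.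

Import Order.TTheory GRing.Theory Num.Theory.

Local Open Scope nat_scope.

(** * Colourings of words and of sequences of words *)

Section Words.
Variable D : finType.
Implicit Type e : D * D.

Section Separation.
Variables (X I : finType) (w : X -> I -> D).

Definition separated e x y := [exists i, (w x i == e.1) && (w y i == e.2)].

Definition colorable (es : seq (D * D)) (r : nat) : Prop :=
  exists c : X -> nat, (forall x, c x < r) /\
    forall x y, x != y -> c x = c y -> all (fun e => separated e x y) es.

Lemma colorable_fin (K : finType) (c : X -> K) es :
  (forall x y, x != y -> c x = c y -> all (fun e => separated e x y) es) ->
  colorable es #|K|.
Proof.
move=> cP; exists (fun x => nat_of_ord (enum_rank (c x))).
split=> [x|x y xy eqc]; first exact: ltn_ord.
by apply: cP => //; apply: enum_rank_inj; apply: val_inj.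
Qed.

Lemma colorable_leq es r s : r <= s -> colorable es r -> colorable es s.
Proof.
by move=> rs [c [cr cP]]; exists c; split=> // x; apply: leq_trans rs.
Qed.

Lemma colorable_nil : colorable [::] 1.
Proof. by exists (fun=> 0). Qed.

(** Pigeonhole: some colour class has at least [t] elements. *)
Lemma colorable_family es r t :
  0 < r -> t * r <= #|X| -> colorable es r ->
  exists f : 'I_t -> X, forall i j, i != j ->
    all (fun e => separated e (f i) (f j)) es.
Proof.
move=> r0 tr [c [cr cP]].
have [j tj] : exists j : 'I_r, t <= #|[set x | c x == j]|.
  apply/existsP; apply: contraLR tr => /existsPn small.
  have -> : #|X| = \sum_(j < r) #|[set x | c x == j]|.
    rewrite -sum1_card (partition_big (fun x => Ordinal (cr x)) predT) //=.
    by apply: eq_bigr => j _; rewrite -sum1_card; apply: eq_bigl => x; rewrite !inE.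
  have : \sum_(j < r) #|[set x | c x == j]|.+1 <= \sum_(j < r) t.
    by apply: leq_sum => j _; rewrite ltnNge small.
  rewrite -ltnNge sum_nat_const card_ord mulnC.
  under eq_bigr do rewrite -addn1.
  rewrite big_split /= sum_nat_const card_ord muln1 => /(leq_trans _); apply.
  by rewrite -addn1 leq_add2l.
pose f (i : 'I_t) := enum_val (widen_ord tj i).
have cf i : c (f i) = j by have := enum_valP (widen_ord tj i); rewrite inE => /eqP.
exists f => i i' neq; apply: cP; last by rewrite !cf.
by apply: contra neq => /eqP/enum_val_inj/(congr1 val)/= /val_inj ->.
Qed.

End Separation.

Section Power.
Variables (X I : finType) (w : X -> I -> D) (L : nat).

Definition pow_word (x : {ffun 'I_L -> X}) (i : I * 'I_L) : D := w (x i.2) i.1.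

Lemma separated_pow e (x y : {ffun 'I_L -> X}) l :
  separated w e (x l) (y l) -> separated pow_word e x y.
Proof. by case/existsP=> i wi; apply/existsP; exists (i, l). Qed.

(** Colour coordinatewise and look at a coordinate where the two sequences differ. This carries
    along the pairs not yet treated. *)
Lemma colorable_pow es r : colorable w es r -> colorable pow_word es (r ^ L).
Proof.
case=> c [cr cP].
rewrite -[X in X ^ L]card_ord -[X in _ ^ X]card_ord -card_ffun.
apply: (@colorable_fin _ _ _ _
  (fun x : {ffun 'I_L -> X} => [ffun l => Ordinal (cr (x l))])).
move=> x y xy /ffunP eqc.
have [l xyl] : exists l, x l != y l.
  apply/existsP; apply: contraNT xy => /existsPn eqxy.
  by apply/eqP/ffunP => l; apply/eqP/negPn/eqxy.
have := eqc l; rewrite !ffunE => /(congr1 val)/= /(cP _ _ xyl).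
by apply: sub_all => e; apply: separated_pow.
Qed.

(* The j-th digit of the colour of a sequence is
   c1 (x_j) - c2 (x_(j-1)) mod r, for 0 <= j <= L, where the terms out of range
   are dropped.  If two sequences have the same colour, then c1 agrees at the
   first position where they differ, and c2 at the last one. *)
Lemma colorable_cat es1 es2 r :
  0 < r -> colorable w es1 r -> colorable w es2 r ->
  colorable pow_word (es1 ++ es2) (r ^ L.+1).
Proof.
move=> r_gt0 [c1 [c1r c1P]] [c2 [c2r c2P]].
(* Positions out of range contribute 0. In [digit], the number [r - c2 u] stands for [- c2 u] modulo
   [r]. *)
pose at_pos (g : X -> nat) (x : {ffun 'I_L -> X}) (j : nat) :=
  oapp (fun l => g (x l)) 0 (insub j).
have at_posE g x (l : 'I_L) : at_pos g x l = g (x l) by rewrite /at_pos valK.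
pose digit x j :=
  at_pos c1 x j + (if j is k.+1 then at_pos (fun u => r - c2 u) x k else 0).
rewrite -[X in X ^ L.+1]card_ord -[X in _ ^ X]card_ord -card_ffun.
apply: (@colorable_fin _ _ _ _ (fun x : {ffun 'I_L -> X} =>
  [ffun j : 'I_L.+1 => Ordinal (ltn_pmod (digit x j) r_gt0)])).
move=> x y xy /ffunP eqc.
have {eqc} eqd j : j <= L -> digit x j = digit y j %[mod r].
  by move=> jL; have := eqc (inord j); rewrite !ffunE => /(congr1 val)/=; rewrite inordK.
have eq_at g j : (forall l : 'I_L, l = j :> nat -> x l = y l) ->
    at_pos g x j = at_pos g y j.
  by rewrite /at_pos; case: insubP => //= l _ lj -> //.
have [l0 xyl0] : exists l, x l != y l.
  apply/existsP; apply: contraNT xy => /existsPn eqxy.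
  by apply/eqP/ffunP => l; apply/eqP/negPn/eqxy.
rewrite all_cat; apply/andP; split.
- case: (@arg_minnP _ l0 (fun l => x l != y l) val xyl0) => l xyl lmin.
  have eq_before k : k < l -> forall l' : 'I_L, l' = k :> nat -> x l' = y l'.
    move=> kl l' l'k; apply/eqP; apply: contraTT kl => /lmin.
    by rewrite -leqNgt -l'k.
  have : c1 (x l) = c1 (y l).
    have := eqd l (ltnW (ltn_ord l)); rewrite /digit !at_posE.
    case E: (nat_of_ord l) => [|k]; last first.
      rewrite (eq_at _ k); last by apply: eq_before; rewrite E.
      by move/eqP; rewrite eqn_modDr !modn_small // => /eqP.
    by rewrite !addn0 !modn_small.
  move/(c1P _ _ xyl); apply: sub_all => e; exact: separated_pow.
- case: (@arg_maxnP _ l0 (fun l => x l != y l) val xyl0) => l xyl lmax.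
  have : c2 (x l) = c2 (y l).
    have := eqd l.+1 (ltn_ord l); rewrite /digit !at_posE.
    rewrite (eq_at _ l.+1); last first.
      move=> l' l'l; apply/eqP; apply: contraT => /lmax /=.
      by rewrite l'l ltnn.
    move/eqP; rewrite eqn_modDl; move: (c2r (x l)) (c2r (y l)).
    move: (c2 (x l)) (c2 (y l)) => u v ur vr.
    rewrite -(eqn_modDr (u + v)).
    have -> : r - u + (u + v) = r + v by lia.
    have -> : r - v + (u + v) = r + u by lia.
    by rewrite eqn_modDl !modn_small // => /eqP.
  move/(c2P _ _ xyl); apply: sub_all => e; exact: separated_pow.
Qed.

End Power.

Lemma colorable_iter (X I : finType) (w : X -> I -> D) (es : seq (D * D)) r L :
  0 < r -> (forall e, e \in es -> colorable w [:: e] r) ->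
  exists (X' I' : finType) (w' : X' -> I' -> D),
    [/\ #|X'| = #|X| ^ (L ^ size es), #|I'| = #|I| * L ^ size es
      & colorable w' es (r ^ (L.+1 ^ size es))].
Proof.
move=> r_gt0 r_es.
(* The fourth clause keeps the induction going: every single pair, treated or not, stays colourable
   on the new words. *)
suff [X' [I' [w' [cX cI cw _]]]] : exists (X' I' : finType) (w' : X' -> I' -> D),
    [/\ #|X'| = #|X| ^ (L ^ size es), #|I'| = #|I| * L ^ size es,
       colorable w' es (r ^ (L.+1 ^ size es))
     & forall e, colorable w [:: e] r -> colorable w' [:: e] (r ^ (L ^ size es))].
  by exists X', I', w'.
elim: es r_es => [|e es IH] r_es.
  exists X, I, w; rewrite !expn0 !expn1 muln1; split=> //.
  exact: colorable_leq (colorable_nil w).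
have [|X' [I' [w' [cX cI cw ce]]]] := IH.
  by move=> e' e'es; apply: r_es; rewrite inE e'es orbT.
exists {ffun 'I_L -> X'}, (I' * 'I_L)%type, (@pow_word _ _ w' L); split=> /=.
- by rewrite card_ffun card_ord cX -expnM expnSr.
- by rewrite card_prod card_ord cI expnSr mulnA.
- rewrite [in L.+1 ^ _]expnSr expnM -cat1s; apply: colorable_cat => //.
    by rewrite expn_gt0 r_gt0.
  (* [colorable_cat] wants equally many colours on both sides, so the count for [e] is raised from
     [r ^ (L ^ size es)] to [r ^ (L.+1 ^ size es)]. *)
  have := ce e (r_es e (mem_head _ _)); apply: colorable_leq.
  by rewrite leq_pexp2l //; case: (size es) => // n; rewrite leq_exp2r.
- by move=> e' /ce /(colorable_pow L); rewrite -expnM -expnSr.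
Qed.

End Words.

(** * Balanced words and the merging of two letters *)

Section Balanced.
Variables (d m : nat).

Definition balanced (x : {ffun 'I_d * 'I_m -> 'I_d}) :=
  [forall a, #|[set i | x i == a]| == m].

Definition balanced_word := {x : {ffun 'I_d * 'I_m -> 'I_d} | balanced x}.

Definition letter (x : balanced_word) := fun_of_fin (val x).

Lemma card_letter (x : balanced_word) a : #|[set i | letter x i == a]| = m.
Proof. by apply/eqP; move: a; apply/forallP; exact: (valP x). Qed.

Lemma balanced_word_gt0 : 0 < #|{: balanced_word}|.
Proof.
have b : balanced [ffun i => i.1].
  apply/forallP => a; rewrite -[X in _ == X]card_ord -cardsT.
  have -> : [set i | [ffun i => i.1] i == a] = [set (a, k) | k in [set: 'I_m]].
    apply/setP => -[u k]; rewrite !inE ffunE /=; apply/eqP/imsetP => [->|].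
      by exists k; rewrite ?inE.
    by case=> k' _ [->].
  by rewrite card_imset // => k k' [].
by apply/card_gt0P; exists (Sub _ b).
Qed.

Lemma card_balanced_word : #|{: balanced_word}| <= d ^ (d * m).
Proof.
have := leq_card _ (@val_inj _ _ balanced_word).
by rewrite card_ffun card_prod !card_ord.
Qed.

Lemma colorable_balanced (e : 'I_d * 'I_d) : e.1 != e.2 ->
  colorable letter [:: e] (#|{: balanced_word}| %/ 'C(m.*2, m)).
Proof.
case: e => a b /= ab.
pose merge (x : balanced_word) : {ffun 'I_d * 'I_m -> 'I_d} :=
  [ffun i => if letter x i == b then a else letter x i].
pose cls y := [set x | merge x == y].
(* The merged word has [2m] letters [a]. Keeping [a] on any [m] of these positions and writing [b]
   on the others gives a balanced word of the same class. *)
have card_cls x : 'C(m.*2, m) <= #|cls (merge x)|.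
  pose S := [set i | merge x i == a].
  have SE i : (i \in S) = (letter x i == a) || (letter x i == b).
    by rewrite inE ffunE; case: (letter x i == b); rewrite ?eqxx ?orbT ?orbF.
  have cardS : #|S| = m.*2.
    have -> : S = [set i | letter x i == a] :|: [set i | letter x i == b].
      by apply/setP => i; rewrite SE !inE.
    rewrite cardsU !card_letter; set Z := _ :&: _.
    have -> : Z = set0.
      apply/setP => i; rewrite !inE; apply: contraNF ab.
      by case/andP => /eqP <- /eqP <-.
    by rewrite cards0 subn0 addnn.
  pose u (A : {set 'I_d * 'I_m}) : {ffun 'I_d * 'I_m -> 'I_d} :=
    [ffun i => if i \in A then a else if i \in S then b else letter x i].
  pose draws := [set A : {set 'I_d * 'I_m} | A \subset S & #|A| == m].
  have u_bal A : A \in draws -> balanced (u A).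
    rewrite inE => /andP[/subsetP AS /eqP cardA]; apply/forallP => c.
    have [->|ca] := eqVneq c a.
      rewrite -[X in _ == X]cardA; apply/eqP/eq_card => i; rewrite inE ffunE SE.
      case: (i \in A); rewrite ?eqxx //.
      by case: ifP => [_|/negbT/norP[/negPf]//]; rewrite eq_sym (negPf ab).
    have [->|cb] := eqVneq c b.
      have -> : [set i | u A i == b] = S :\: A.
        apply/setP => i; rewrite 2!inE ffunE SE; case: (i \in A) => /=.
          exact: negPf.
        by case: ifP => [_|/negbT/norP[_ /negPf]]; rewrite ?eqxx.
      rewrite cardsD (setIidPr _) ?cardS ?cardA -?addnn ?addnK //.
      exact/subsetP.
    rewrite -[X in _ == X](card_letter x c); apply/eqP/eq_card => i.
    rewrite !inE ffunE; case: ifP => [/AS|_]; rewrite SE.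
      by case/orP => /eqP ->; rewrite !(eq_sym _ c) (negPf ca) ?(negPf cb).
    by case: ifP => // /orP[] /eqP ->; rewrite !(eq_sym _ c) ?(negPf ca) (negPf cb).
  (* The default [x] of [insubd] never occurs, since [u A] is balanced for [A] in [draws]. *)
  rewrite -cardS -cards_draws -/draws -(@card_in_imset _ _ (fun A => insubd x (u A))).
    apply/subset_leq_card/subsetP => _ /imsetP[A AD ->].
    rewrite inE; apply/eqP/ffunP => i; rewrite !ffunE.
    have -> : letter (insubd x (u A)) = u A by rewrite /letter insubdK //; apply: u_bal.
    move: AD; rewrite inE => /andP[/subsetP AS _].
    rewrite ffunE SE; case: (boolP (i \in A)) => [/AS|_].
      by rewrite SE (negPf ab) => /orP[]/eqP->; rewrite ?eqxx ?(negPf ab).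
    case: (eqVneq (letter x i) a) => [->|_] /=; first by rewrite eqxx (negPf ab).
    by case: (eqVneq (letter x i) b) => //=; rewrite ?eqxx // => /negPf ->.
  move=> A B AD BD /(congr1 val); rewrite !insubdK; try exact: u_bal; move=> /ffunP eqAB.
  have uE (C : {set 'I_d * 'I_m}) i : (i \in C) = (u C i == a).
    rewrite ffunE SE; case: (i \in C); rewrite ?eqxx //.
    by case: ifP => [_|/negbT/norP[/negPf-> _]//]; rewrite eq_sym (negPf ab).
  by apply/setP => i; rewrite !uE // eqAB.
pose im := [set merge x | x in [set: balanced_word]].
have mem_im x : merge x \in im by apply: imset_f; rewrite inE.
apply: (@colorable_leq _ _ _ _ _ #|im|).
  rewrite leq_divRL; last by rewrite bin_gt0 -addnn leq_addl.
  rewrite -[X in _ <= X]sum1_card (partition_big merge (mem im)) /=; last first.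
    by move=> x _; apply: mem_im.
  rewrite -sum_nat_const; apply: leq_sum => y /imsetP[x _ ->].
  apply: leq_trans (card_cls x) _; rewrite -sum1_card eq_leq //.
  by apply: eq_bigl => z; rewrite inE.
exists (fun x => index (merge x) (enum im)); split=> [x|x y xy].
  by rewrite cardE index_mem mem_enum mem_im.
move/(congr1 (nth (merge x) (enum im))); rewrite !nth_index ?mem_enum ?mem_im //.
move/ffunP => eqm; rewrite /= andbT.
apply: contraT => /existsPn nsep.
case/negP: xy; apply/eqP/val_inj.
(* If no position shows (a, b), every [a] of [x] faces an [a] of [y]. Both words have [m] of them,
   so these positions coincide, and equal merges then force [x = y]. *)
have sub : [set i | letter x i == a] \subset [set i | letter y i == a].
  apply/subsetP => i; rewrite !inE => xa; have := nsep i; rewrite /= xa /=.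
  have := eqm i; rewrite !ffunE (eqP xa) (negPf ab).
  by case: ifP => // _ ->; rewrite eqxx.
have /eqP eqS : [set i | letter x i == a] == [set i | letter y i == a].
  by rewrite eqEcard sub !card_letter leqnn.
apply/ffunP => i; have := eqm i; have /setP/(_ i) := eqS; rewrite !inE !ffunE.
rewrite -/(letter x i) -/(letter y i).
case: (eqVneq (letter x i) a) => [->|xa]; first by move=> /esym/eqP ->.
move=> /esym/negbT ya.
case: (eqVneq (letter x i) b) => [->|xb];
  case: (eqVneq (letter y i) b) => [->|yb] // eqxy.
- by rewrite -eqxy eqxx in ya.
- by rewrite eqxy eqxx in xa.
Qed.

End Balanced.

(** * Integer inequalities, and the family of words *)

Lemma leq_expn_central_bin m : 4 ^ m <= 'C(m.*2, m) * m.*2.+1.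
Proof.
elim: m => // m IH.
have rec : m.+1 * 'C(m.+1.*2, m.+1) = (m.*2.+1).*2 * 'C(m.*2, m).
  have sym : 'C(m.*2.+1, m) = 'C(m.*2.+1, m.+1).
    by rewrite -[RHS]bin_sub; [congr 'C(_, _); lia | lia].
  rewrite doubleS binS sym addnn -doubleMr -[RHS]doubleMl.
  by rewrite -(mul_bin_diag m.*2.+1).
rewrite -(leq_pmul2l (ltn0Sn m)) mulnA rec expnS.
move: IH; move: ('C(_, _)) (4 ^ m) => u v uv; nia.
Qed.

(** Bernoulli's inequality (1 - 1/(n+1))^k >= 1 - k/(n+1), cleared of denominators. *)
Lemma leq_expnS_ratio n k : n.+1 ^ k.+1 <= n ^ k * n.+1 + k * n.+1 ^ k.
Proof.
elim: k => [|k IH]; first by rewrite !expn0 mul1n mul0n addn0 expn1.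
have le_k : n ^ k <= n.+1 ^ k by case: (k) => // j; rewrite leq_exp2r.
rewrite !expnS in IH *; move: (n ^ k) (n.+1 ^ k) IH le_k => u v IH le_k; nia.
Qed.

Definition letter_pairs d : seq ('I_d * 'I_d) := enum [pred e | e.1 != e.2].

(** With [n] balanced words and [r] colours per pair, pigeonhole asks for
    [t * r ^ (L.+1 ^ k) <= n ^ (L ^ k)]. The ratio n/r is at least C(2m, m) >= 4^m/(2m+1), and each
    of the [L.+1 ^ k - L ^ k] excess factors [r] is at most [d ^ (d * m)]. *)
Lemma separated_family d m L t : 1 < d ->
  let k := size (letter_pairs d) in
  t * m.*2.+1 ^ (L ^ k) * d ^ (d * m * (L.+1 ^ k - L ^ k)) <= 4 ^ (m * L ^ k) ->
  exists (I : finType) (f : 'I_t -> I -> 'I_d),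
    #|I| = d * m * L ^ k /\
    forall i i' a b, i != i' -> a != b -> exists c, f i c = a /\ f i' c = b.
Proof.
move=> d_gt1 k bound.
set n := #|{: balanced_word d m}|; set r := n %/ 'C(m.*2, m).
have mem_pairs e : (e \in letter_pairs d) = (e.1 != e.2) by rewrite mem_enum.
have colE e : e \in letter_pairs d -> colorable (@letter d m) [:: e] r.
  by rewrite mem_pairs; apply: colorable_balanced.
(* Colouring a nonempty set takes at least one colour; [d_gt1] supplies a pair to colour for. *)
have r_gt0 : 0 < r.
  have [|c [cr _]] := colE (Ordinal (ltnW d_gt1), Ordinal d_gt1).
    by rewrite mem_pairs.
  have /card_gt0P[x _] := balanced_word_gt0 d m.
  exact: leq_ltn_trans (cr x).
have [X' [I [w [cX cI cw]]]] := colorable_iter L r_gt0 colE.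
have [||f fP] := colorable_family (t := t) _ _ cw.
- by rewrite expn_gt0 r_gt0.
- rewrite cX -/k -/n.
  have LL : L ^ k <= L.+1 ^ k by case: (k) => // j; rewrite leq_exp2r.
  rewrite -(subnKC LL) expnD.
  have rX : r * 'C(m.*2, m) <= n by apply: leq_trunc_div.
  have rd : r <= d ^ (d * m) by apply: leq_trans (card_balanced_word d m); apply: leq_div.
  have Q_gt0 : 0 < m.*2.+1 ^ (L ^ k) by rewrite expn_gt0.
  rewrite -(leq_pmul2r Q_gt0).
  apply: (@leq_trans (t * m.*2.+1 ^ (L ^ k) * d ^ (d * m * (L.+1 ^ k - L ^ k))
                      * r ^ (L ^ k))).
    rewrite [d ^ _]expnM.
    have : r ^ (L.+1 ^ k - L ^ k) <= (d ^ (d * m)) ^ (L.+1 ^ k - L ^ k).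
      by case: (L.+1 ^ k - L ^ k) => // j; rewrite leq_exp2r.
    move=> leAB; rewrite (mulnC (r ^ L ^ k)) mulnA mulnAC leq_mul2r (mulnAC t).
    by rewrite leq_mul2l leAB !orbT.
  apply: leq_trans (leq_mul bound (leqnn _)) _.
  apply: (@leq_trans (('C(m.*2, m) * m.*2.+1) ^ (L ^ k) * r ^ (L ^ k))).
    rewrite leq_mul2r expnM; apply/orP; right.
    by case: (L ^ k) => // j; rewrite leq_exp2r // leq_expn_central_bin.
  rewrite expnMn mulnAC leq_mul2r -expnMn mulnC; apply/orP; right.
  by case: (L ^ k) => // j; rewrite leq_exp2r.
exists I, (fun i => w (f i)); split.
  by rewrite cI card_prod !card_ord.
move=> i i' a b ii' ab; have /allP/(_ (a, b)) := fP _ _ ii'.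
by rewrite mem_pairs => /(_ ab)/existsP[c /andP[/eqP ? /eqP ?]]; exists c.
Qed.

(** The point [inr j] lies in [A i j] for every [i], which settles equal letters. For fixed [i] the
    sets partition the ground set, hence the size. *)
Lemma tuples_of_separated t d (I : finType) (f : 'I_t -> I -> 'I_d) :
  (forall i i' a b, i != i' -> a != b -> exists c, f i c = a /\ f i' c = b) ->
  exists (T : finType) (A : 'I_t -> 'I_d -> {set T}),
    tuple_disjointness A /\ total_size A = t * (#|I| + d).
Proof.
move=> fP.
pose g i (s : I + 'I_d) := match s with inl c => f i c | inr a => a end.
exists (I + 'I_d)%type, (fun i j => [set s | g i s == j]); split.
  move=> i i' j j'; split=> [disj|[<- jj']]; last first.
    apply/setP => s; rewrite !inE; apply/negP => /andP[/eqP gj /eqP gj'].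
    by apply: jj'; rewrite -gj.
  have nos s : g i s = j -> g i' s = j' -> False.
    by move=> gj gj'; have /setP/(_ s) := disj; rewrite !inE gj gj' !eqxx.
  have jj' : j <> j' by move=> eqj; apply: (nos (inr j)).
  split=> //; apply/eqP; apply: contraT => ii'.
  have [c [fj fj']] := fP _ _ _ _ ii' (introN eqP jj').
  by case: (nos (inl c)).
rewrite /total_size; under eq_bigr => i _.
  have -> : \sum_(j < d) #|[set s | g i s == j]| = #|I| + d.
    rewrite -[X in _ + X]card_ord -card_sum -sum1_card (partition_big (g i) predT) //=.
    by apply: eq_bigr => j _; rewrite -sum1_card; apply: eq_bigl => s; rewrite inE.
  over.
by rewrite sum_nat_const card_ord.
Qed.

Local Open Scope ring_scope.

(** * Logarithmic estimates *)

Section Asymptotics.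
Variable R : realType.

Lemma ln_eventually_le_linear (c : R) : 0 < c ->
  exists m0 : nat, forall m, (m0 <= m)%N -> ln (m.*2.+1%:R : R) <= c * m%:R.
Proof.
(* From ln z < z at z = (c/4)(2m+1) one gets ln(2m+1) < cm/2 + c/4 - ln(c/4), which is at most cm
   once m >= K. *)
move=> c_gt0; pose K : R := (c / 4 - ln (c / 4)) * 2 / c.
exists (Num.trunc K).+1 => m; rewrite -(ler_nat R) => le_m.
have Km : K < m%:R by apply: lt_le_trans le_m; exact: truncnS_gt.
have c4 : 0 < c / 4 by rewrite divr_gt0.
have m_pos : 0 < m.*2.+1%:R :> R by rewrite ltr0n.
have /ltW := ln_sublinear (mulr_gt0 c4 m_pos).
rewrite lnM ?posrE // -[X in c / 4 * X]natr1 -muln2 natrM => le_ln.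
move: Km; rewrite /K ltr_pdivrMr // => Km.
move: le_ln Km; move: (ln _) (ln _) => u v; nra.
Qed.

Lemma log2_eventually_ge (K : R) :
  exists t0 : nat, forall t, (t0 <= t)%N -> (0 < t)%N /\ K <= log2 (t%:R : R).
Proof.
have ln2 : 0 < ln 2 :> R by rewrite ln_gt0 // ltr1n.
exists (2 ^ (Num.trunc K).+1)%N => t le_t.
have t_gt0 : (0 < t)%N by apply: leq_trans le_t; rewrite expn_gt0.
split=> //; rewrite /log2 ler_pdivlMr //.
apply: (@le_trans _ _ ((Num.trunc K).+1%:R * ln 2)).
  by rewrite ler_pM2r // ltW // truncnS_gt.
rewrite mulr_natl -lnXn // ler_ln ?posrE ?exprn_gt0 ?ltr0n //.
by rewrite -natrX ler_nat.
Qed.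

Lemma ln_nat_le (d : nat) : (0 < d)%N -> ln (d%:R : R) <= d%:R * ln 2.
Proof.
move=> d_gt0; rewrite mulr_natl -lnXn // ler_ln ?posrE ?exprn_gt0 ?ltr0n //.
by rewrite -natrX ler_nat ltnW // ltn_expl.
Qed.

Lemma exists_expn_ratio (k : nat) (delta : R) : 0 < delta ->
  exists L : nat, (0 < L)%N /\
    (L.+1 ^ k - L ^ k)%N%:R <= delta * (L ^ k)%N%:R.
Proof.
move=> delta_gt0; pose q := (Num.trunc (k%:R / delta)).+1.
have kq : k%:R <= delta * q%:R.
  by rewrite mulrC -ler_pdivrMr // ltW // truncnS_gt.
(* With a = L^k and b = (L+1)^k, Bernoulli gives (b - a)(q + 1) <= k a for this [L], and k <= delta
   q. *)
exists (q + k)%N; split; first by rewrite addn_gt0.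
set L := (q + k)%N.
have := leq_expnS_ratio L k.
have LL : (L ^ k <= L.+1 ^ k)%N by case: (k) => // j; rewrite leq_exp2r.
rewrite -(ler_nat R) natrB // !expnS !(natrD, natrM).
have : L%:R = q%:R + k%:R :> R by rewrite natrD.
move: LL; rewrite -(ler_nat R).
have : 0 <= (L ^ k)%N%:R :> R by [].
move: ((L ^ k)%N%:R) ((L.+1 ^ k)%N%:R) => a b a_ge0 ab LE.
have -> : L.+1%:R = q%:R + k%:R + 1 :> R by rewrite -natr1 LE.
have q_gt0 : 0 < q%:R :> R by rewrite ltr0n.
move=> ratio; have q1 : 0 < q%:R + 1 :> R by lra.
rewrite -(ler_pM2r q1); nra.
Qed.

(** Take logarithms in units of m N ln 2: the right side is 2, [t] takes at most 2 - 2 eta, and the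
    other two factors at most eta each. The square of [d] comes from the crude bound ln d <= d ln
    2. *)
Lemma counting_bound (d t m N p : nat) (eta : R) :
  (0 < d)%N -> (0 < t)%N ->
  p%:R <= eta / d%:R ^+ 2 * N%:R ->
  ln (m.*2.+1%:R : R) <= eta * ln 2 * m%:R ->
  log2 (t%:R : R) <= m%:R * N%:R * (2 - 2 * eta) ->
  (t * m.*2.+1 ^ N * d ^ (d * m * p) <= 4 ^ (m * N))%N.
Proof.
move=> d_gt0 t_gt0 le_p le_m le_t.
have ln2 : 0 < ln 2 :> R by rewrite ln_gt0 // ltr1n.
have dR : 0 < d%:R :> R by rewrite ltr0n.
have ln4 : ln 4 = 2 * ln 2 :> R.
  by rewrite (_ : 4 = 2 ^+ 2) ?lnXn ?mulr_natl // -natrX.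
rewrite -(ler_nat R) -ler_ln ?posrE ?ltr0n ?muln_gt0 ?expn_gt0 ?d_gt0 ?t_gt0 //.
rewrite !natrM !natrX !lnM ?lnXn ?posrE ?mulr_gt0 ?exprn_gt0 ?ltr0n //.
rewrite -[ln d%:R *+ _]mulr_natl -[ln _.+1%:R *+ _]mulr_natl -[ln 4 *+ _]mulr_natl.
rewrite ln4 !natrM.
have h1 : N%:R * ln m.*2.+1%:R <= N%:R * (eta * ln 2 * m%:R) :> R.
  exact: ler_wpM2l.
have h2 : d%:R * m%:R * p%:R * ln d%:R <= eta * N%:R * m%:R * ln 2 :> R.
  apply: (@le_trans _ _ (d%:R * m%:R * p%:R * (d%:R * ln 2))).
    by apply: ler_wpM2l (ln_nat_le d_gt0); rewrite !mulr_ge0.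
  rewrite mulrA ler_pM2r // (_ : _ * d%:R = m%:R * (p%:R * d%:R ^+ 2)); last by ring.
  rewrite (_ : eta * _ * _ = m%:R * (eta * N%:R)); last by ring.
  apply: ler_wpM2l => //; rewrite -ler_pdivlMr ?exprn_gt0 //.
  by rewrite mulrAC.
have h3 : ln t%:R <= m%:R * N%:R * (2 - 2 * eta) * ln 2 :> R.
  by rewrite -ler_pdivrMr.
lra.
Qed.

End Asymptotics.

(** * Choice of the parameters *)

Theorem theorem6 (R : realType) (d : nat) (eps : R) (hd : (2 <= d)%N)
  (heps : 0 < eps) :
  exists (C : R) (t0 : nat),
    C < 1 / 2 + eps /\
    forall t : nat, (t0 <= t)%N ->
      exists (T : finType) (A : 'I_t -> 'I_d -> {set T}),
        tuple_disjointness A /\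
        (total_size A)%:R <= C * d%:R * t%:R * log2 (t%:R : R).
Proof.
have d_gt0 : (0 < d)%N := ltnW hd.
have dR : 0 < d%:R :> R by rewrite ltr0n.
have ln2 : 0 < ln 2 :> R by rewrite ln_gt0 // ltr1n.
(* Chosen so that 1/(2 - 2 eta) = 1/2 + eps/4, leaving another eps/4 for lower order terms. *)
pose eta : R := eps / (2 + eps).
have eta_gt0 : 0 < eta by rewrite divr_gt0 // addr_gt0.
have etaE : (2 - 2 * eta) * (1 / 2 + eps / 4) = 1.
  by rewrite /eta; field; rewrite gt_eqF // addr_gt0.
have eta_lt1 : 0 < 2 - 2 * eta by nra.
set k := size (letter_pairs d).
have [L [L_gt0 ratioL]] := exists_expn_ratio k (divr_gt0 eta_gt0 (exprn_gt0 2 dR)).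
have [m0 m0P] := ln_eventually_le_linear (mulr_gt0 eta_gt0 ln2).
pose N : R := (L ^ k)%N%:R.
have N_gt0 : 0 < N by rewrite ltr0n expn_gt0 L_gt0.
(* The first summand ensures m >= m0. The second gives N + 1 <= (eps/4) log2 t, where N pays for
   rounding [m] and 1 for the private points. *)
have [t0 t0P] := log2_eventually_ge (m0%:R * (N * (2 - 2 * eta)) + (N + 1) * 4 / eps).
exists (1 / 2 + eps / 2), t0; split; first by lra.
move=> t /t0P[t_gt0]; set y := log2 _ => le_y.
have m0N : 0 <= m0%:R * (N * (2 - 2 * eta)) by rewrite !mulr_ge0 // ltW.
have N4 : 0 < (N + 1) * 4 / eps by rewrite divr_gt0 // mulr_gt0 // addr_gt0.
have M_gt0 : 0 < N * (2 - 2 * eta) by rewrite mulr_gt0.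
have y_ge0 : 0 <= y / (N * (2 - 2 * eta)) by rewrite divr_ge0 // ltW //; lra.
(* [m] is the least integer above this quotient: enough for [counting_bound], and at most 1 too
   large. *)
have /andP[] := truncn_itv y_ge0.
set m := (Num.trunc _).+1 => le_m lt_m.
have {}le_m : m%:R <= y / (N * (2 - 2 * eta)) + 1.
  by rewrite /m -natr1 lerD2r.
have m0m : (m0 <= m)%N.
  rewrite -(ler_nat R); apply: le_trans (ltW lt_m).
  by rewrite ler_pdivlMr //; lra.
have le_t : y <= m%:R * N * (2 - 2 * eta).
  by rewrite -mulrA -ler_pdivrMr // ltW.
have [I [f [cI fP]]] :=
  separated_family hd (counting_bound d_gt0 t_gt0 ratioL (m0P _ m0m) le_t).
have [T [A [AP sizeA]]] := tuples_of_separated fP.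
exists T, A; split=> //.
rewrite sizeA cI -/k natrM natrD !natrM -/N.
have mN : m%:R * N <= y * (1 / 2 + eps / 4) + N.
  have -> : y * (1 / 2 + eps / 4) = y / (N * (2 - 2 * eta)) * N.
    have <- : (2 - 2 * eta)^-1 = 1 / 2 + eps / 4.
      by apply: (mulfI (lt0r_neq0 eta_lt1)); rewrite etaE divff ?lt0r_neq0.
    by field; rewrite !lt0r_neq0.
  by rewrite -[X in _ + X]mul1r -mulrDl ler_pM2r.
have y4 : N + 1 <= eps / 4 * y.
  rewrite mulrAC ler_pdivlMr // mulrC [eps * y]mulrC -ler_pdivrMr // [4 * _]mulrC; lra.
rewrite (_ : _ * (_ + _) = d%:R * t%:R * (m%:R * N + 1)); last by ring.
rewrite (_ : _ * y = d%:R * t%:R * ((1 / 2 + eps / 2) * y)); last by ring.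
rewrite ler_pM2l ?mulr_gt0 ?ltr0n //; lra.
Qed.
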